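(* Let $\mathbf{k}$ be a commutative ring with unit, $\lambda\in\mathbf{k}$, and $\Omega$ a semigroup. (1) A Rota-Baxter family algebra $(R,\{P_\omega\mid\omega\in\Omega\})$ of weight $\lambda$ induces a dendriform family algebra $(R,\{\prec_\omega,\succ_\omega\mid\omega\in\Omega\})$, where $$x\prec_\omega y:=xP_\omega(y)+\lambda xy\quad\text{and}\quad x\succ_\omega y:=P_\omega(x)y,\qquad x,y\in R,\ \omega\in\Omega.$$ (2) A tridendriform family algebra $(T,\{\prec_\omega,\succ_\omega\mid\omega\in\Omega\},\cdot)$ induces a dendriform family algebra $(T,\{\prec'_\omega,\succ'_\omega\mid\omega\in\Omega\})$, where $$x\prec'_\omega y:=x\prec_\omega y+x\cdot y\quad\text{and}\quad x\succ'_\omega y:=x\succ_\omega y,\qquad x,y\in T,\ \omega\in\Omega.$$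
   Context: Algebras are associative $\mathbf{k}$-algebras (not necessarily unital or commutative). $\Omega$ is a semigroup, not necessarily commutative. All binary operations on $\mathbf{k}$-modules are $\mathbf{k}$-bilinear. A Rota-Baxter family algebra of weight $\lambda$ (indexed by $\Omega$) is a pair $(R,\{P_\omega\mid\omega\in\Omega\})$ with $R$ an algebra and $P_\omega:R\to R$ $\mathbf{k}$-linear operators such that $P_\alpha(a)P_\beta(b)=P_{\alpha\beta}\bigl(P_\alpha(a)b+aP_\beta(b)+\lambda ab\bigr)$ for all $a,b\in R$, $\alpha,\beta\in\Omega$. A dendriform family algebra is a $\mathbf{k}$-module $D$ with binary operations $\{\prec_\omega,\succ_\omega\mid\omega\in\Omega\}$ such that for all $x,y,z\in D$ and $\alpha,\beta\in\Omega$: $(x\prec_\alpha y)\prec_\beta z=x\prec_{\alpha\beta}(y\prec_\beta z+y\succ_\alpha z)$; $(x\succ_\alpha y)\prec_\beta z=x\succ_\alpha(y\prec_\beta z)$; $(x\prec_\beta y+x\succ_\alpha y)\succ_{\alpha\beta}z=x\succ_\alpha(y\succ_\beta z)$. A tridendriform family algebra is a $\mathbf{k}$-module $T$ with binary operations $\{\prec_\omega,\succ_\omega\mid\omega\in\Omega\}$ and a binary operation $\cdot$ such that for all $x,y,z\in T$ and $\alpha,\beta\in\Omega$: $(x\prec_\alpha y)\prec_\beta z=x\prec_{\alpha\beta}(y\prec_\beta z+y\succ_\alpha z+y\cdot z)$; $(x\succ_\alpha y)\prec_\beta z=x\succ_\alpha(y\prec_\beta z)$; $(x\prec_\beta y+x\succ_\alpha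 y+x\cdot y)\succ_{\alpha\beta}z=x\succ_\alpha(y\succ_\beta z)$; $(x\succ_\alpha y)\cdot z=x\succ_\alpha(y\cdot z)$; $(x\prec_\alpha y)\cdot z=x\cdot(y\succ_\alpha z)$; $(x\cdot y)\prec_\alpha z=x\cdot(y\prec_\alpha z)$; $(x\cdot y)\cdot z=x\cdot(y\cdot z)$. *)

(* Defs.v *)
From HB Require Import structures.
From mathcomp Require Import all_boot all_algebra.

Set Implicit Arguments.
Unset Strict Implicit.
Unset Printing Implicit Defensive.

Import GRing.Theory.
Local Open Scope ring_scope.

(* The [bilinear_for] of sesquilinear.v is restricted to nonzero base rings, and
   the algebra structures of ssralg.v are all unital; hence the next two
   definitions. *)
Definition bilinear_op (k : comPzRingType) (V : lmodType k)
    (op : V -> V -> V) : Prop :=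
  (forall x, linear (op x)) /\ (forall y, linear (fun x => op x y)).

Record is_algebra (k : comPzRingType) (A : lmodType k)
    (mul : A -> A -> A) : Prop := {
  alg_bilinear : bilinear_op mul;
  alg_assoc : associative mul
}.

Record is_rota_baxter_family (k : comPzRingType) (lambda : k)
    (Omega : semigroupType) (R : lmodType k) (mul : R -> R -> R)
    (P : Omega -> R -> R) : Prop := {
  rbf_algebra : is_algebra mul;
  rbf_linear : forall w, linear (P w);
  rbf_rota_baxter : forall (a b : R) (alpha beta : Omega),
    mul (P alpha a) (P beta b) =
    P (alpha * beta)%g
      (mul (P alpha a) b + mul a (P beta b) + lambda *: mul a b)
}.

Record is_dendriform_family (k : comPzRingType) (Omega : semigroupType)
    (D : lmodType k) (prec succ : Omega -> D -> D -> D) : Prop := {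
  df_prec_bilinear : forall w, bilinear_op (prec w);
  df_succ_bilinear : forall w, bilinear_op (succ w);
  df_prec_prec : forall (x y z : D) (alpha beta : Omega),
    prec beta (prec alpha x y) z =
    prec (alpha * beta)%g x (prec beta y z + succ alpha y z);
  df_succ_prec : forall (x y z : D) (alpha beta : Omega),
    prec beta (succ alpha x y) z = succ alpha x (prec beta y z);
  df_succ_succ : forall (x y z : D) (alpha beta : Omega),
    succ (alpha * beta)%g (prec beta x y + succ alpha x y) z =
    succ alpha x (succ beta y z)
}.

Record is_tridendriform_family (k : comPzRingType) (Omega : semigroupType)
    (T : lmodType k) (prec succ : Omega -> T -> T -> T) (dot : T -> T -> T)
    : Prop := {
  tdf_prec_bilinear : forall w, bilinear_op (prec w);
  tdf_succ_bilinear : forall w, bilinear_op (succ w);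
  tdf_dot_bilinear : bilinear_op dot;
  tdf_prec_prec : forall (x y z : T) (alpha beta : Omega),
    prec beta (prec alpha x y) z =
    prec (alpha * beta)%g x (prec beta y z + succ alpha y z + dot y z);
  tdf_succ_prec : forall (x y z : T) (alpha beta : Omega),
    prec beta (succ alpha x y) z = succ alpha x (prec beta y z);
  tdf_succ_succ : forall (x y z : T) (alpha beta : Omega),
    succ (alpha * beta)%g (prec beta x y + succ alpha x y + dot x y) z =
    succ alpha x (succ beta y z);
  tdf_succ_dot : forall (x y z : T) (alpha : Omega),
    dot (succ alpha x y) z = succ alpha x (dot y z);
  tdf_prec_dot : forall (x y z : T) (alpha : Omega),
    dot (prec alpha x y) z = dot x (succ alpha y z);
  tdf_dot_prec : forall (x y z : T) (alpha : Omega),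
    prec alpha (dot x y) z = dot x (prec alpha y z);
  tdf_dot_assoc : forall x y z : T, dot (dot x y) z = dot x (dot y z)
}.

(* Main.v *)
(* A Rota-Baxter family algebra of weight lambda is a tridendriform family algebra
   for x P_w(y), P_w(x) y and lambda x y, and merging the product of a
   tridendriform family algebra into its left operations yields a dendriform
   family algebra; so part (1) is an instance of part (2). *)
Require Import Defs.
From HB Require Import structures.
From mathcomp Require Import all_boot all_algebra.

Set Implicit Arguments.
Unset Strict Implicit.
Unset Printing Implicit Defensive.

Import GRing.Theory.
Local Open Scope ring_scope.

Section BilinearOp.

Variables (k : comPzRingType) (V : lmodType k).
Implicit Types (op : V -> V -> V) (f : V -> V).

(** [linear] is a single identity in [a *: x + y]: the scalar 1 yields additivity, cancellation then
    yields vanishing at 0, and a zero second summand yields [scalable]. *)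
Lemma bilinear_opDr op : bilinear_op op -> forall x, {morph op x : y z / y + z}.
Proof. by case=> opr _ x y z; have := opr x 1 y z; rewrite !scale1r. Qed.

Lemma bilinear_opDl op : bilinear_op op -> forall y, {morph op^~ y : x z / x + z}.
Proof. by case=> _ opl y x z; have := opl y 1 x z; rewrite !scale1r. Qed.

Lemma bilinear_op0r op : bilinear_op op -> forall x, op x 0 = 0.
Proof. by move=> bop x; apply: (addrI (op x 0)); rewrite -(bilinear_opDr bop) !addr0. Qed.

Lemma bilinear_op0l op : bilinear_op op -> forall y, op 0 y = 0.
Proof.
by move=> bop y; apply: (addrI (op 0 y)); rewrite -(bilinear_opDl bop) !addr0.
Qed.

Lemma bilinear_opZr op : bilinear_op op -> forall x, scalable (op x).
Proof.
by move=> bop x a y; have := bop.1 x a y 0; rewrite (bilinear_op0r bop) !addr0.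
Qed.

Lemma bilinear_opZl op : bilinear_op op -> forall y, scalable (op^~ y).
Proof.
by move=> bop y a x; have := bop.2 y a x 0; rewrite (bilinear_op0l bop) !addr0.
Qed.

Lemma bilinear_opD op1 op2 : bilinear_op op1 -> bilinear_op op2 ->
  bilinear_op (fun x y => op1 x y + op2 x y).
Proof.
move=> [r1 l1] [r2 l2]; split=> [x a y z | y a x z].
  by rewrite r1 r2 scalerDr addrACA.
by rewrite l1 l2 scalerDr addrACA.
Qed.

(** Commutativity of [k] is what lets [c] pass the scalar [a]. *)
Lemma bilinear_opZ c op : bilinear_op op -> bilinear_op (fun x y => c *: op x y).
Proof.
move=> [opr opl]; split=> [x a y z | y a x z].
  by rewrite opr scalerDr !scalerA mulrC.
by rewrite opl scalerDr !scalerA mulrC.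
Qed.

Lemma bilinear_op_compr op f : bilinear_op op -> linear f ->
  bilinear_op (fun x y => op x (f y)).
Proof.
by move=> [opr opl] lf; split=> [x a y z | y a x z]; rewrite ?lf ?opr ?opl.
Qed.

Lemma bilinear_op_compl op f : bilinear_op op -> linear f ->
  bilinear_op (fun x y => op (f x) y).
Proof.
by move=> [opr opl] lf; split=> [x a y z | y a x z]; rewrite ?lf ?opr ?opl.
Qed.

End BilinearOp.

(** The axioms for iterated [prec] and iterated [succ] are the Rota-Baxter identity multiplied by
    [x] on the left and by [z] on the right; the other five are associativity of [mul], with
    [lambda] pulled out where it occurs. *)
Lemma rota_baxter_tridendriform (k : comPzRingType) (lambda : k)
    (Omega : semigroupType) (R : lmodType k) (mul : R -> R -> R)
    (P : Omega -> R -> R) :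
  is_rota_baxter_family lambda mul P ->
  is_tridendriform_family (fun w x y => mul x (P w y))
    (fun w x y => mul (P w x) y) (fun x y => lambda *: mul x y).
Proof.
case=> -[bmul mulA] linP rbP.
have mulZl y a x : mul (a *: x) y = a *: mul x y := bilinear_opZl bmul y a x.
have mulZr x a y : mul x (a *: y) = a *: mul x y := bilinear_opZr bmul x a y.
split=> [w | w | | x y z a b | x y z a b | x y z a b | x y z a | x y z a
        | x y z a | x y z] /=.
- exact: bilinear_op_compr.
- exact: bilinear_op_compl.
- exact: bilinear_opZ.
- by rewrite -mulA rbP (addrC (mul (P a y) z)).
- by rewrite mulA.
- by rewrite mulA rbP (addrC (mul (P a x) y)).
- by rewrite mulZr mulA.
- by rewrite mulA.
- by rewrite mulZl mulA.
- by rewrite mulZl mulZr mulA.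
Qed.

Lemma tridendriform_dendriform (k : comPzRingType) (Omega : semigroupType)
    (T : lmodType k) (prec succ : Omega -> T -> T -> T) (dot : T -> T -> T) :
  is_tridendriform_family prec succ dot ->
  is_dendriform_family (fun w x y => prec w x y + dot x y) succ.
Proof.
case=> bprec bsucc bdot prec_prec succ_prec succ_succ succ_dot prec_dot dot_prec dotA.
split=> [w | // | x y z a b | x y z a b | x y z a b] /=.
- exact: bilinear_opD.
(* The left side expands into four terms, and each is reassociated by its own axiom. *)
- rewrite (bilinear_opDl (bprec b)) (bilinear_opDl bdot).
  rewrite prec_prec dot_prec prec_dot dotA !(bilinear_opDr bdot).
  (* The two sides now differ only in the order of [succ a y z] and [dot y z], once inside [prec]
     and once under [dot x]. *)
  by rewrite (addrAC (prec b y z)) -!addrA; congr (_ + (_ + _)); rewrite addrC.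
- by rewrite succ_prec succ_dot -(bilinear_opDr (bsucc a)).
- by rewrite addrAC succ_succ.
Qed.

Theorem proposition2p10 (k : comPzRingType) (lambda : k)
    (Omega : semigroupType) :
  (forall (R : lmodType k) (mul : R -> R -> R) (P : Omega -> R -> R),
     is_rota_baxter_family lambda mul P ->
     is_dendriform_family
       (fun (w : Omega) (x y : R) => mul x (P w y) + lambda *: mul x y)
       (fun (w : Omega) (x y : R) => mul (P w x) y)) /\
  (forall (T : lmodType k) (prec succ : Omega -> T -> T -> T)
          (dot : T -> T -> T),
     is_tridendriform_family prec succ dot ->
     is_dendriform_family
       (fun (w : Omega) (x y : T) => prec w x y + dot x y)
       (fun (w : Omega) (x y : T) => succ w x y)).
Proof.
split=> [R mul P rbP | T prec succ dot tdT]; last exact: tridendriform_dendriform.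
(* Merging [lambda *: mul x y] into [mul x (P w y)] gives the required left operation by
   beta-reduction. *)
exact: tridendriform_dendriform (rota_baxter_tridendriform rbP).
Qed.
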